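(* Let $X=[0,1]$ or $X=\mathbb{S}^1$, with the metric $|\cdot|$ inherited from the line. Then the set $\{\phi\in C^0(X): \mathrm{mdim}_M(X,\phi,|\cdot|)=1\}$ is dense in $C^0(X)$. (This is asserted both for the lower metric mean dimension $\underline{\mathrm{mdim}_M}$ and for the upper metric mean dimension $\overline{\mathrm{mdim}_M}$.)
   Context: The interval $[0,1]$ carries the metric $|x-y|$ and the circle $\mathbb{S}^1=\mathbb{R}/\mathbb{Z}$ the quotient (arc-length) metric. For a compact metric space $(X,d)$, $C^0(X)$ is the set of continuous maps $X\to X$ with the uniform metric $d(\phi,\varphi)=\max_{x\in X}d(\phi(x),\varphi(x))$. For $\phi\in C^0(X)$ and $n\ge1$ let $d_n(x,y)=\max_{0\le j\le n-1}d(\phi^j(x),\phi^j(y))$. A set $A\subset X$ is $(n,\phi,\varepsilon)$-separated if $d_n(x,y)>\varepsilon$ for all distinct $x,y\in A$; $\mathrm{sep}(n,\phi,\varepsilon)$ is the maximal cardinality of such a set, and $\mathrm{sep}(\phi,\varepsilon)=\limsup_{n\to\infty}\frac1n\log \mathrm{sep}(n,\phi,\varepsilon)$. The lower and upper metric mean dimensions are $$\underline{\mathrm{mdim}_M}(X,\phi,d)=\liminf_{\varepsilon\to0}\frac{\mathrm{sep}(\phi,\varepsilon)}{|\log\varepsilon|},\qquad \overline{\mathrm{mdim}_M}(X,\phi,d)=\limsup_{\varepsilon\to0}\frac{\mathrm{sep}(\phi,\varepsilon)}{|\log\varepsilon|}.$$ The symbol $\mathrm{mdim}_M$ without underline or overline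 means that the assertion holds for each of the two. *)

(* Defs.v *)
From HB Require Import structures.
From mathcomp Require Import all_boot all_order all_algebra.
From mathcomp Require Import generic_quotient archimedean finmap zify ring lra.
From mathcomp Require Import all_classical all_reals all_analysis.

Set Implicit Arguments.
Unset Strict Implicit.
Unset Printing Implicit Defensive.

Import Order.TTheory GRing.Theory Num.Theory.
Import numFieldNormedType.Exports.

Local Open Scope classical_set_scope.
Local Open Scope ring_scope.

HB.mixin Record Metric_isCompact (R : realType) X & Metric R X := {
  compactT : compact [set: X]
}.

#[short(type="compactMetricType")]
HB.structure Definition CompactMetric (R : realType) :=
  { X of Metric R X & Metric_isCompact R X }.

Section metric_facts.
Context {R : realType}.

Lemma mdist_continuous (X : metricType R) (x0 : X) :
  continuous (mdist x0 : X -> R^o).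
Proof.
move=> x; apply/(@metricType_numDomainType.cvgrPdist_lt R R^o) => e e0.
apply: (filterS _ (nbhsx_ballx x e e0)) => y; rewrite ballEmdist/= => xy.
have h1 := metric_triangle x0 x y; have h2 := metric_triangle x0 y x.
rewrite (metric_sym y x) in h2.
rewrite [ltLHS](_ : _ = `|mdist x0 y - mdist x0 x|)//.
by rewrite ltr_norml; apply/andP; split; lra.
Qed.

Lemma mdist_bounded (X : compactMetricType R) :
  exists M : R, forall x y : X, mdist x y <= M.
Proof.
have [[x0 _]|X0] := pselect (exists x : X, True); last first.
  by exists 0 => x; case: X0; exists x.
have /compact_bounded : compact ((mdist x0 : X -> R^o) @` [set: X]).
  apply: continuous_compact; last exact: compactT.
  exact/continuous_subspaceT/mdist_continuous.
move=> [M [_ /(_ (M + 1))]]; rewrite ltrDl ltr01 => /(_ isT) hM.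
exists ((M + 1) + (M + 1)) => x y.
have h z : mdist x0 z <= M + 1.
  by apply: le_trans (ler_norm _) (hM _ _); exists z.
apply: le_trans (metric_triangle x x0 y) _.
by rewrite metric_sym lerD.
Qed.

End metric_facts.

Definition C0 (R : realType) (X : compactMetricType R) : Type :=
  continuousType X X.

Section C0_metric.
Context {R : realType} (X : compactMetricType R).

HB.instance Definition _ := Choice.on (C0 X).

(* The supremum is a maximum: X is compact. *)
Definition unif_dist (f g : C0 X) : R :=
  sup (range (fun x => mdist (f x)
                             (g x))).

Lemma unif_dist_ub (f g : C0 X) x :
  mdist (f x) (g x)
    <= unif_dist f g.
Proof.
have [M hM] := mdist_bounded X.
apply: ub_le_sup; last by exists x.
by exists M => _ [y _ <-].
Qed.

Lemma unif_dist_le (f g : C0 X) M : 0 <= M ->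
  (forall x, mdist (f x)
                   (g x) <= M) -> unif_dist f g <= M.
Proof.
move=> M0 hM; rewrite /unif_dist; set A := (X in sup X).
have [->|/set0P A0] := eqVneq A set0; first by rewrite sup0.
by apply: ge_sup => // _ [x _ <-].
Qed.

Lemma unif_dist_ge0 (f g : C0 X) : 0 <= unif_dist f g.
Proof.
rewrite /unif_dist; set A := (X in sup X).
have [->|/set0P[_ [x _ _]]] := eqVneq A set0; first by rewrite sup0.
exact: le_trans (mdist_ge0 _ _) (unif_dist_ub f g x).
Qed.

Lemma unif_distxx (f : C0 X) : unif_dist f f = 0.
Proof.
apply/eqP; rewrite eq_le unif_dist_ge0 andbT.
by apply: unif_dist_le => // x; rewrite mdistxx.
Qed.

Lemma unif_dist_positivity (f g : C0 X) : unif_dist f g = 0 -> f = g.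
Proof.
move=> fg; apply/(@continuousEP X X) => x; apply: mdist_positivity.
by apply/eqP; rewrite eq_le mdist_ge0 andbT -fg unif_dist_ub.
Qed.

Lemma unif_dist_sym (f g : C0 X) : unif_dist f g = unif_dist g f.
Proof.
by congr sup; apply/seteqP; split=> _ [x _ <-]; exists x; rewrite // metric_sym.
Qed.

Lemma unif_dist_triangle (g f h : C0 X) :
  unif_dist f h <= unif_dist f g + unif_dist g h.
Proof.
apply: unif_dist_le => [|x]; first by rewrite addr_ge0 ?unif_dist_ge0.
apply: le_trans (metric_triangle _ (g x) _) _.
by rewrite lerD ?unif_dist_ub.
Qed.

HB.instance Definition _ := @isMetric.Build R (C0 X) unif_dist
  unif_distxx unif_dist_positivity unif_dist_sym unif_dist_triangle.

End C0_metric.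

Definition unit_interval (R : realType) : Type :=
  set_type (`[0%R, 1%R]%classic : set R).

Section unit_interval_metric.
Context (R : realType).

HB.instance Definition _ := PseudoMetric.on (unit_interval R).

Definition interval_dist (x y : unit_interval R) : R := `|set_val x - set_val y|.

Let interval_dist_positivity x y : interval_dist x y = 0 -> x = y.
Proof. by move/normr0_eq0/eqP; rewrite subr_eq0 => /eqP/val_inj. Qed.

HB.instance Definition _ := @PseudoMetric_isMetric.Build R (unit_interval R)
  interval_dist (fun _ _ => normr_ge0 _) interval_dist_positivity
  (fun _ _ => erefl).

Lemma unit_interval_compact : compact [set: unit_interval R].
Proof.
move=> F FF _.
have [|p [p01 Fp]] := @segment_compact R 0 1 (set_val @ F) _.
  by apply: (@filterS _ F) filterT => -[x x01] _; exact: set_mem x01.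
exists (exist _ p (mem_set p01)); split=> // A B FA /nbhs_ballP[e/= e0 eB].
have [|_ [[x Ax <-] px]] := Fp (set_val @` A) (ball p e) _ (nbhsx_ballx p e e0).
  by apply: (@filterS _ F) FA => x Ax; exists x.
by exists x; split=> //; exact: eB.
Qed.

HB.instance Definition _ :=
  Metric_isCompact.Build R (unit_interval R) unit_interval_compact.

End unit_interval_metric.

Section circle_def.
Context (R : realType).

Definition int_eq (x y : R) : bool := (x - y) \is a Num.int.

Lemma int_eq_equiv : equiv_class_of int_eq.
Proof.
split=> [x|x y|y x z]; rewrite /int_eq ?subrr ?rpred0//.
  by rewrite -opprB rpredN.
move=> xy yz; rewrite (_ : x - z = (x - y) + (y - z)); last by ring.
exact: rpredD.
Qed.

Canonical int_eq_equivrel := EquivRelPack int_eq_equiv.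

Definition circle : Type := {eq_quot int_eq}%qT.

HB.instance Definition _ := EqQuotient.on circle.
HB.instance Definition _ := Choice.on circle.

Definition to_circle (x : R) : circle := \pi_circle%qT x.

(* The quotient metric, an infimum over all representatives. *)
Definition circle_dist (a b : circle) : R :=
  inf [set `|x - y| | x in [set x | to_circle x = a]
                    & y in [set y | to_circle y = b]].

Lemma to_circle_eqP (x y : R) : to_circle x = to_circle y <-> int_eq x y.
Proof. by split=> [/eqmodP|xy]//; apply/eqmodP. Qed.

Lemma to_circle_surj (a : circle) : exists x, to_circle x = a.
Proof. by exists (repr a); rewrite /to_circle reprK. Qed.

Lemma circle_dist_le (x y : R) :
  circle_dist (to_circle x) (to_circle y) <= `|x - y|.
Proof.
apply: ge_inf; last by exists x => //; exists y.
by exists 0 => _ [? _ [? _ <-]].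
Qed.

Lemma circle_dist_adherent (a b : circle) (e : R) : 0 < e ->
  exists x y, [/\ to_circle x = a, to_circle y = b &
                  `|x - y| < circle_dist a b + e].
Proof.
move=> e0; rewrite /circle_dist; set A := (X in inf X).
have [|_ [x xa [y yb <-]] lt_e] := @inf_adherent R A e e0.
  split; last by exists 0 => _ [? _ [? _ <-]].
  have [x xa] := to_circle_surj a; have [y yb] := to_circle_surj b.
  by exists `|x - y|; exists x => //; exists y.
by exists x, y.
Qed.

Lemma circle_dist_ge0 (a b : circle) : 0 <= circle_dist a b.
Proof.
have [x xa] := to_circle_surj a; have [y yb] := to_circle_surj b.
apply: lb_le_inf; last by move=> _ [? _ [? _ <-]].
by exists `|x - y|; exists x => //; exists y.
Qed.

Lemma circle_distxx (a : circle) : circle_dist a a = 0.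
Proof.
apply/eqP; rewrite eq_le circle_dist_ge0 andbT.
have [x <-] := to_circle_surj a.
by apply: le_trans (circle_dist_le x x) _; rewrite subrr normr0.
Qed.

Lemma circle_dist_sym (a b : circle) : circle_dist a b = circle_dist b a.
Proof.
congr inf; apply/seteqP; split=> _ [x xa [y yb <-]].
  by exists y => //; exists x => //; rewrite distrC.
by exists y => //; exists x => //; rewrite distrC.
Qed.

Lemma circle_dist_triangle (b a c : circle) :
  circle_dist a c <= circle_dist a b + circle_dist b c.
Proof.
apply/ler_addgt0Pr => e e0; have e20 : 0 < e / 2 by rewrite divr_gt0.
have [x [y [xa yb xy]]] := circle_dist_adherent a b e20.
have [y' [z [yb' zc yz]]] := circle_dist_adherent b c e20.
have /to_circle_eqP yy' : to_circle y = to_circle y' by rewrite yb yb'.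
have xa' : to_circle (x - (y - y')) = a.
  rewrite -xa; apply/to_circle_eqP; rewrite /int_eq.
  by rewrite (_ : _ - x = - (y - y')) ?rpredN//; ring.
rewrite -xa' -zc; apply: le_trans (circle_dist_le _ _) _.
rewrite (_ : _ - z = (x - y) + (y' - z)); last by ring.
apply: le_trans (ler_normD _ _) _; rewrite {}zc {}xa'; lra.
Qed.

Lemma circle_dist_positivity (a b : circle) : circle_dist a b = 0 -> a = b.
Proof.
move=> ab0; have h0 : 0 < 1 / 2 :> R by rewrite divr_gt0.
have [x [y [xa yb]]] := circle_dist_adherent a b h0; rewrite ab0 add0r => xy.
have [xy0|xy0] := eqVneq x y; first by rewrite -xa -yb xy0.
have t0 : 0 < `|x - y| by rewrite normr_gt0 subr_eq0.
have [x' [y' [xa' yb']]] := circle_dist_adherent a b t0.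
rewrite ab0 add0r => xy'.
have /to_circle_eqP xx : to_circle x = to_circle x' by rewrite xa xa'.
have /to_circle_eqP yy : to_circle y = to_circle y' by rewrite yb yb'.
have /intrP[k kE] : (x - y) - (x' - y') \is a Num.int.
  rewrite (_ : _ - _ = (x - x') - (y - y')); last by ring.
  exact: rpredB.
have k1 : `|k%:~R| < 1 :> R.
  by rewrite -kE; apply: le_lt_trans (ler_normB _ _) _; lra.
have k0 : k = 0 by move: k1; rewrite -intr_norm ltrz1; lia.
move: kE; rewrite k0 => /eqP; rewrite subr_eq0 => /eqP kE.
by move: xy'; rewrite kE ltxx.
Qed.

HB.instance Definition _ := @isMetric.Build R circle circle_dist
  circle_distxx circle_dist_positivity circle_dist_sym circle_dist_triangle.

Lemma to_circle_continuous : continuous to_circle.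
Proof.
move=> x; apply/metricType_numDomainType.cvgrPdist_lt => e e0.
apply: (filterS _ (nbhsx_ballx x e e0)) => y xy.
exact: le_lt_trans (circle_dist_le _ _) xy.
Qed.

Lemma circle_compact : compact [set: circle].
Proof.
rewrite (_ : [set: circle] = to_circle @` `[0, 1]).
  apply: continuous_compact; last exact: segment_compact.
  exact/continuous_subspaceT/to_circle_continuous.
apply/seteqP; split=> // a _; have [x <-] := to_circle_surj a.
exists (x - (Num.floor x)%:~R).
  rewrite /= in_itv/= subr_ge0 floor_le_tmp/=.
  by have := floorD1_gt x; rewrite intrD; lra.
apply/to_circle_eqP; rewrite /int_eq.
by rewrite (_ : _ - x = - (Num.floor x)%:~R) ?rpredN ?intr_int//; ring.
Qed.

HB.instance Definition _ := Metric_isCompact.Build R circle circle_compact.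

End circle_def.

Section metric_mean_dimension.
Context {R : realType} {X : metricType R}.
Implicit Types (phi : X -> X) (n : nat) (eps : R).

Definition dyn_dist phi n (x y : X) : R :=
  \big[Num.max/0]_(j < n) mdist (iter j phi x) (iter j phi y).

Definition separated n phi eps (A : set X) : Prop :=
  forall x y, A x -> A y -> x <> y -> eps < dyn_dist phi n x y.

Local Open Scope ereal_scope.

(* The supremum is the maximal cardinality whenever it is finite, e.g. for
   compact X, continuous phi and eps > 0. *)
Definition sep n phi eps : \bar R :=
  ereal_sup [set (#|` A|%:R)%:E | A in [set A : {fset X} |
                                         separated n phi eps [set` A]]].

Definition sep_rate phi eps : \bar R :=
  limn_esup (fun n => (n%:R^-1)%:E * lne (sep n phi eps)).

Definition lower_mdim phi : \bar R :=
  limf_einf (fun eps : R => sep_rate phi eps * (`|ln eps|^-1)%:E) 0^'+.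

Definition upper_mdim phi : \bar R :=
  limf_esup (fun eps : R => sep_rate phi eps * (`|ln eps|^-1)%:E) 0^'+.

End metric_mean_dimension.

(* Main.v *)
Require Import Defs.
From mathcomp Require Import all_boot all_order all_algebra.
From mathcomp Require Import generic_quotient archimedean finmap zify ring lra.
From mathcomp Require Import all_classical all_reals all_analysis.

(** The upper bound holds for every self-map: [X] is covered by about [1/eps]
    cells of diameter less than [eps], and the points of an
    [(n, phi, eps)]-separated set have distinct itineraries of length [n].

    For the lower bound, the map [h t = t (1 - cos (exp (1/t)))] has, on
    [[a, 2a]], about [exp (1/a)] full branches at mutual distance at least
    [a^2 exp (-1/a)]; letting [a] tend to [0] shows that [h] has lower metric
    mean dimension at least [1]. Given [f], the pigeonhole principle provides a
    point that nearly returns after [q] steps; for [q] minimal, the [q] points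
    visited are far apart. An arbitrarily small perturbation of [f] then maps a
    short arc issued from each of these points to the arc issued from the next
    one by [h], so that [f] becomes [h] times a cyclic permutation on the union
    of the arcs. Periodic orbits longer than [1] cannot be avoided on the circle,
    and the perturbation must act by [h] at every step: iterating [h] only once
    per period would divide the dimension by [q]. *)

Set Implicit Arguments.
Unset Strict Implicit.
Unset Printing Implicit Defensive.

Import Order.TTheory GRing.Theory Num.Theory.
Import numFieldNormedType.Exports.

Local Open Scope classical_set_scope.
Local Open Scope ring_scope.

(** * Bounds for limits inferior and superior along a filter *)

Section limf.
Context {R : realType} {T : choiceType} {X : filteredType T}.
Implicit Types (f : X -> \bar R) (F : set_system X).
Local Open Scope ereal_scope.

Lemma limf_esup_le f F V (l : \bar R) :
  F V -> (forall x, V x -> f x <= l) -> limf_esup f F <= l.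
Proof.
move=> FV Vf; rewrite limf_esupE.
apply: (@le_trans _ _ (ereal_sup (f @` V))).
  by apply: ereal_inf_lbound; exists V.
by apply: ge_ereal_sup => _ [x Vx <-]; exact: Vf.
Qed.

Lemma limf_einf_ge f F V (l : \bar R) :
  F V -> (forall x, V x -> l <= f x) -> l <= limf_einf f F.
Proof.
move=> FV Vf; rewrite /limf_einf leeNr; apply: (limf_esup_le FV) => x Vx.
by rewrite leeN2; exact: Vf.
Qed.

Lemma limf_esup_ge f F {FF : ProperFilter F} V (l : \bar R) :
  F V -> (forall x, V x -> l <= f x) -> l <= limf_esup f F.
Proof.
move=> FV Vf; rewrite limf_esupE; apply: le_ereal_inf_tmp => _ [W FW <-].
have [x [Vx Wx]] := filter_ex (filterI FV FW).
by apply: (le_trans (Vf _ Vx)); apply: ereal_sup_ubound; exists x.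
Qed.

Lemma limf_einf_le_esup f F {FF : ProperFilter F} :
  limf_einf f F <= limf_esup f F.
Proof.
rewrite limf_einfE; apply: ge_ereal_sup => _ [V FV <-].
apply: limf_esup_ge FV _ => x Vx.
by apply: ereal_inf_lbound; exists x.
Qed.
End limf.

(** * Upper bound: counting itineraries *)

Section upper_bound.
Context {R : realType} {X : metricType R}.
Implicit Types (phi : X -> X) (eps : R).

(** Two points with the same itinerary through the cells stay [eps]-close for [n] steps, so on a
    separated set the itinerary map into the [N ^ n] words is injective. *)
Lemma card_separated_le n phi eps N (cell : X -> 'I_N) (A : {fset X}) :
  0 <= eps -> (forall x y, cell x = cell y -> mdist x y <= eps) ->
  Defs.separated n phi eps [set` A] -> (#|` A| <= N ^ n)%N.
Proof.
move=> eps0 cellP sepA.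
pose F (x : A) := [ffun j : 'I_n => cell (iter j phi (val x))].
suff injF : injective F by have := leq_card F injF; rewrite card_ffun !card_ord -cardfE.
move=> x y Fxy; apply/eqP/negPn/negP => xy.
have nxy : val x <> val y by move=> /val_inj/eqP; rewrite (negbTE xy).
have := sepA (val x) (val y) (valP x) (valP y) nxy.
rewrite ltNge => /negP; apply; rewrite /dyn_dist; apply: bigmax_le => // j _.
by apply: cellP; have /ffunP/(_ j) := Fxy; rewrite !ffunE.
Qed.

Lemma sep_le_pow n phi eps N (cell : X -> 'I_N) :
  0 <= eps -> (forall x y, cell x = cell y -> mdist x y <= eps) ->
  (sep n phi eps <= ((N ^ n)%:R)%:E)%E.
Proof.
move=> eps0 cellP; apply: ge_ereal_sup => _ [A sepA <-].
by rewrite lee_fin ler_nat; exact: (card_separated_le eps0 cellP sepA).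
Qed.

Lemma sep_rate_le phi eps N (cell : X -> 'I_N) (x0 : X) :
  0 <= eps -> (forall x y, cell x = cell y -> mdist x y <= eps) ->
  (sep_rate phi eps <= (ln N%:R)%:E)%E.
Proof.
move=> eps0 cellP; have N0 : (0 < N)%N by case: (cell x0) => m; exact: leq_ltn_trans.
apply: (@limf_esup_le _ _ _ _ _ [set n | (0 < n)%N]).
  by exists 1%N.
move=> n /= n0.
have h : (lne (sep n phi eps) <= (ln N%:R *+ n)%:E)%E.
  rewrite -lnXn ?ltr0n// -natrX -lne_EFin ?ltr0n ?expn_gt0 ?N0//.
  rewrite lee_lne ?in_itv/= ?leey ?andbT ?lee_fin ?ler0n//.
    exact: (sep_le_pow _ _ eps0 cellP).
  (* The empty set is separated, so [sep] is nonnegative and lies where [lne] is monotone. *)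
  by apply: ereal_sup_ubound; exists fset0.
apply: (@le_trans _ _ ((n%:R^-1)%:E * (ln N%:R *+ n)%:E)%E).
  by rewrite lee_wpmul2l// lee_fin invr_ge0.
by rewrite -EFinM lee_fin -[X in _ * X]mulr_natl mulKf// pnatr_eq0 -lt0n.
Qed.

Lemma lower_mdim_le_upper phi : (lower_mdim phi <= upper_mdim phi)%E.
Proof. exact: limf_einf_le_esup. Qed.

(** The cells are the preimages under [c] of the half-open intervals of length [e] starting at
    multiples of [e]. There are at most [e^-1 + 1] of them, which is below [2 / e] since [e < 1]. *)
Lemma ex_small_cells (c : X -> R) (e : R) :
  (forall x, 0 <= c x <= 1) -> (forall x y, mdist x y <= `|c x - c y|) ->
  0 < e < 1 ->
  exists N (cell : X -> 'I_N), N%:R <= 2 / e /\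
    forall x y, cell x = cell y -> mdist x y < e.
Proof.
move=> c01 cdist /andP[e0 e1].
have ie1 : 1 < e^-1 by rewrite invf_gt1.
set N := (Num.truncn e^-1).+1.
have cellP x : (Num.truncn (c x / e) < N)%N.
  rewrite ltnS le_truncn// ler_piMl ?invr_ge0 ?(ltW e0)//.
  by case/andP: (c01 x).
exists N, (fun x => Ordinal (cellP x)); split.
  rewrite /N -natr1; have := truncn_le e^-1; rewrite invr_ge0 (ltW e0); lra.
move=> x y /(congr1 val)/= cxy; apply: le_lt_trans (cdist x y) _.
have cx : 0 <= c x / e by rewrite divr_ge0 ?(ltW e0)//; case/andP: (c01 x).
have cy : 0 <= c y / e by rewrite divr_ge0 ?(ltW e0)//; case/andP: (c01 y).
have /andP[h1 h2] := truncn_itv cx; have /andP[h3 h4] := truncn_itv cy.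
have -> : c x - c y = (c x / e - c y / e) * e by field; rewrite gt_eqF.
rewrite normrM (gtr0_norm e0) gtr_pMl// ltr_norml.
rewrite cxy in h1 h2; move: h2 h4; rewrite -natr1 => h2 h4.
by apply/andP; split; lra.
Qed.

(** With at most [2 / e] cells the quotient is at most [1 + ln 2 / |ln e|], hence at most [1 + k]
    once [e < expR (- (ln 2 / k))]. *)
Lemma upper_mdim_le1 phi (c : X -> R) (x0 : X) :
  (forall x, 0 <= c x <= 1) -> (forall x y, mdist x y <= `|c x - c y|) ->
  (upper_mdim phi <= 1)%E.
Proof.
move=> c01 cdist; apply/lee_addgt0Pr => k k0; rewrite -EFinD.
have b0 : 0 < Num.min 1 (expR (- (ln 2 / k))) :> R.
  by rewrite lt_min expR_gt0 andbT; lra.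
apply: (@limf_esup_le _ _ _ _ _
  [set e | 0 < e /\ e < Num.min 1 (expR (- (ln 2 / k)))]).
  by apply: filterI; [exact: nbhs_right_gt | exact: nbhs_right_lt].
move=> e /= [e0]; rewrite lt_min => /andP[e1 ek].
have [|N [cell [hN cc]]] := ex_small_cells (e := e) c01 cdist; first by rewrite e0.
have N0 : (0 < N)%N by case: (cell x0) => m; exact: leq_ltn_trans.
have le0 : ln e < 0 by rewrite ln_lt0// e0/=; lra.
have h := sep_rate_le phi x0 (ltW e0) (fun x y xy => ltW (cc x y xy)).
apply: (@le_trans _ _ ((ln N%:R)%:E * (`|ln e|^-1)%:E)%E).
  by rewrite lee_wpmul2r// lee_fin invr_ge0.
rewrite -EFinM lee_fin ltr0_norm// ler_pdivrMr ?oppr_gt0//.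
have : ln (N%:R : R) <= ln 2 - ln e.
  by rewrite -lnV ?posrE// -lnM ?posrE ?invr_gt0// ler_ln ?posrE ?mulr_gt0 ?invr_gt0 ?ltr0n.
have : ln e < - (ln 2 / k) by rewrite -[ltRHS]expRK ltr_ln ?posrE ?expR_gt0.
rewrite -ltrNr ltr_pdivrMr//; lra.
Qed.

End upper_bound.

(** * The model map on the half-line and its coding by words *)

Section horseshoe.
Context {R : realType}.
Implicit Types (a t u v y : R) (i j n : nat).

(** The graph oscillates between [0] and [2 * t], and the exponential makes the number of
    oscillations above [a] exponential in [a^-1]. The factor [t] gives the value [0] and continuity
    at [0], whatever the convention for [0^-1]. *)
Definition horseshoe (t : R) : R := t * (1 - cos (expR t^-1)).

Lemma horseshoe_ge0 t : 0 <= t -> 0 <= horseshoe t.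
Proof. by move=> t0; rewrite mulr_ge0// subr_ge0 cos_le1. Qed.

Lemma horseshoe_le t : 0 <= t -> horseshoe t <= 2 * t.
Proof.
move=> t0; rewrite /horseshoe mulrC ler_wpM2r//.
by have := cos_geN1 (expR t^-1); lra.
Qed.

Lemma normr_horseshoe_le t : `|horseshoe t| <= 2 * `|t|.
Proof.
rewrite /horseshoe normrM mulrC ler_wpM2r// ger0_norm ?subr_ge0 ?cos_le1//.
by have := cos_geN1 (expR t^-1); lra.
Qed.

Lemma continuous_horseshoe : continuous horseshoe.
Proof.
move=> t; have [->|t0] := eqVneq t 0.
  apply/cvgrPdist_lt => e e0; near=> s.
  rewrite {1}/horseshoe mul0r sub0r normrN.
  apply: le_lt_trans (normr_horseshoe_le s) _.
  rewrite mulrC -ltr_pdivlMr//; near: s.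
  by apply: (@nbhs0_lt _ R^o); rewrite divr_gt0.
apply: cvgM; first exact: cvg_id.
apply: cvgB; first exact: cvg_cst.
apply: continuous_comp; last exact: continuous_cos.
apply: continuous_comp; last exact: continuous_expR.
exact: cvgV.
Unshelve. all: by end_near. Qed.

Lemma cos_even_pi i : cos (2 * pi * i%:R : R) = 1.
Proof.
elim: i => [|i IH]; first by rewrite mulr0 cos0.
rewrite (_ : _ * _ = 2 * pi * i%:R + pi *+ 2) ?cosD2pi//.
by rewrite -natr1 mulr2n; ring.
Qed.

Lemma cos_odd_pi i : cos (2 * pi * i%:R + pi : R) = -1.
Proof. by rewrite cosDpi cos_even_pi. Qed.

(** Let [u <= v] be the points where [expR t^-1] equals [2 * pi * i + pi] and [2 * pi * i]. The map
    takes the value [2 * u], at least [2 * a], at [u] and [0] at [v], so the intermediate value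
    theorem yields every [y] in between. *)
Lemma horseshoe_branch a i y : 0 < a ->
  expR (2 * a)^-1 <= 2 * pi * i%:R -> 2 * pi * i%:R + pi <= expR a^-1 ->
  0 <= y <= 2 * a ->
  exists t, [/\ a <= t <= 2 * a,
    2 * pi * i%:R <= expR t^-1 <= 2 * pi * i%:R + pi & horseshoe t = y].
Proof.
move=> a0 ia ai /andP[y0 ya].
have p0 := pi_gt0 R; set p := 2 * pi * i%:R in ia ai *.
have pp0 : 0 < p by apply: lt_le_trans ia; exact: expR_gt0.
have ppi : 0 < p + pi by rewrite addr_gt0.
have lnp : (2 * a)^-1 <= ln p by rewrite -[leLHS]expRK ler_ln ?posrE ?expR_gt0.
have lnpi : ln (p + pi) <= a^-1 by rewrite -[leRHS]expRK ler_ln ?posrE ?expR_gt0.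
have lnpp : ln p <= ln (p + pi) by rewrite ler_ln ?posrE//; lra.
have ln0 : 0 < ln p by apply: lt_le_trans lnp; rewrite invr_gt0 mulr_gt0.
have ln1 : 0 < ln (p + pi) by apply: lt_le_trans lnpp.
set u := (ln (p + pi))^-1; set v := (ln p)^-1.
have u0 : 0 < u by rewrite invr_gt0.
have uv : u <= v by rewrite lef_pV2 ?posrE.
have au : a <= u by rewrite -[leLHS]invrK lef_pV2 ?posrE ?invr_gt0.
have va : v <= 2 * a by rewrite -[leRHS]invrK lef_pV2 ?posrE ?invr_gt0 ?mulr_gt0.
have hu : horseshoe u = 2 * u.
  by rewrite /horseshoe /u invrK lnK ?posrE// cos_odd_pi; ring.
have hv : horseshoe v = 0.
  by rewrite /horseshoe /v invrK lnK ?posrE// cos_even_pi; ring.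
have [||t] := @IVT R horseshoe u v y uv.
- exact/continuous_subspaceT/continuous_horseshoe.
- rewrite hu hv ge_min le_max y0 orbT/=; apply/orP; left; lra.
rewrite in_itv/= => /andP[ut tv] ht; exists t; split => //.
  by apply/andP; split; lra.
have t0 : 0 < t by lra.
apply/andP; split.
  rewrite -(lnK (x := p)) ?posrE// ler_expR -[leLHS]invrK.
  by rewrite lef_pV2 ?posrE ?invr_gt0.
rewrite -(lnK (x := p + pi)) ?posrE// ler_expR -[leRHS]invrK.
by rewrite lef_pV2 ?posrE ?invr_gt0.
Qed.

(** Between distinct branches [expR t^-1] changes by at least [pi], while its slope on [t >= a] is
    at most [expR a^-1 / a ^+ 2] in absolute value. The inequality is strict because [pi > 1]. *)
Lemma horseshoe_gap a i i' u v : 0 < a -> (i < i')%N ->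
  a <= u -> a <= v ->
  expR u^-1 <= 2 * pi * i%:R + pi -> 2 * pi * i'%:R <= expR v^-1 ->
  a ^+ 2 * expR (- a^-1) < `|u - v|.
Proof.
move=> a0 ii au av hu hv.
have p2 : 2 <= pi :> R := pi_ge2 R.
have u0 : 0 < u by lra. have v0 : 0 < v by lra.
have diff : pi <= expR v^-1 - expR u^-1.
  have : (i%:R + 1 : R) <= i'%:R by rewrite natr1 ler_nat.
  move=> /(ler_wpM2l (ltW (pi_gt0 R))); lra.
have E0 := expR_gt0 a^-1.
have va : expR v^-1 <= expR a^-1 by rewrite ler_expR lef_pV2 ?posrE.
have vu : u^-1 < v^-1 by rewrite -ltr_expR; lra.
(* The tangent inequality for the exponential at [v^-1] stands in for the mean value theorem. *)
have h1 : expR v^-1 - expR u^-1 <= expR v^-1 * (v^-1 - u^-1).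
  have := expR_ge1Dx (u^-1 - v^-1).
  move=> /(ler_wpM2l (expR_ge0 v^-1)).
  by rewrite -expRD (addrC v^-1) subrK; lra.
have h2 : v^-1 - u^-1 <= (u - v) / a ^+ 2.
  rewrite (_ : v^-1 - u^-1 = (u - v) / (u * v)); last first.
    by field; rewrite !gt_eqF.
  have uv : v < u by rewrite -ltf_pV2 ?posrE.
  rewrite ler_wpM2l ?subr_ge0 ?(ltW uv)//.
  by rewrite lef_pV2 ?posrE ?exprn_gt0 ?mulr_gt0// expr2 ler_pM// ltW.
have uv : v < u by rewrite -ltf_pV2 ?posrE.
rewrite gtr0_norm ?subr_gt0// expRN ltr_pdivrMr//.
have a20 : 0 < a ^+ 2 by rewrite exprn_gt0.
have h3 : pi <= expR a^-1 * ((u - v) / a ^+ 2).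
  apply: le_trans diff _; apply: le_trans h1 _.
  by apply: ler_pM => //; rewrite subr_ge0 ltW.
move: h3; rewrite mulrA ler_pdivlMr// => h3.
apply: lt_le_trans (_ : pi * a ^+ 2 <= _); last by rewrite [leRHS]mulrC.
by rewrite ltr_pMl//; lra.
Qed.

(** Each admissible branch maps onto a set containing [[a, 2a]], so a point realizing the tail of
    the word has a preimage in the branch named by its head. *)
Lemma horseshoe_word a (w : seq nat) : 0 < a ->
  (forall i, i \in w ->
    expR (2 * a)^-1 <= 2 * pi * i%:R /\ 2 * pi * i%:R + pi <= expR a^-1) ->
  exists t, a <= t <= 2 * a /\ forall j, (j < size w)%N ->
    a <= iter j horseshoe t <= 2 * a /\
    2 * pi * (nth 0%N w j)%:R <= expR (iter j horseshoe t)^-1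
                              <= 2 * pi * (nth 0%N w j)%:R + pi.
Proof.
move=> a0; elim: w => [|i w IH] hw.
  by exists a; split => //; apply/andP; split; lra.
have [|t [ta tw]] := IH; first by move=> k kw; apply: hw; rewrite inE kw orbT.
have [|h1 h2] := hw i; first by rewrite inE eqxx.
have [|s [sa si hs]] := horseshoe_branch (y := t) a0 h1 h2.
  by case/andP: ta => ? ?; apply/andP; split; lra.
exists s; split => // -[_|j jw]; first by split.
by rewrite iterSr hs; exact: tw.
Qed.

(** The alphabet is the [M] branches numbered from [M] to [2M - 1]; the two hypotheses make the
    first and the last of them fit in [[a, 2a]]. Different words differ at some time [j], when
    [horseshoe_gap] separates the orbits. *)
Lemma horseshoe_code a M n : 0 < a ->
  expR (2 * a)^-1 <= 2 * pi * M%:R -> 4 * pi * M%:R <= expR a^-1 ->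
  exists T : {ffun 'I_n -> 'I_M} -> R,
    (forall w j, (j < n)%N -> a <= iter j horseshoe (T w) <= 2 * a) /\
    forall w w', w != w' -> exists2 j : 'I_n, true &
      a ^+ 2 * expR (- a^-1)
        < `|iter j horseshoe (T w) - iter j horseshoe (T w')|.
Proof.
move=> a0 hM1 hM2; have p0 := pi_gt0 R.
pose W (w : {ffun 'I_n -> 'I_M}) := [seq (M + w j)%N | j : 'I_n <- enum 'I_n].
have sW w : size (W w) = n by rewrite size_map size_enum_ord.
have nW w (j : 'I_n) : nth 0%N (W w) j = (M + w j)%N.
  by rewrite (nth_map j) ?size_enum_ord// nth_ord_enum.
have hW w i : i \in W w ->
    expR (2 * a)^-1 <= 2 * pi * i%:R /\ 2 * pi * i%:R + pi <= expR a^-1.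
  move=> /mapP[j _ ->]; split.
    apply: le_trans hM1 _; rewrite ler_wpM2l ?mulr_ge0 ?(ltW p0)//.
    by rewrite ler_nat leq_addr.
  apply: le_trans hM2.
  have : ((M + w j)%N.+1%:R : R) <= (M + M)%:R by rewrite ler_nat ltn_add2l.
  by rewrite -natr1 !natrD => /(ler_wpM2l (ltW p0)); lra.
have /choice[T hT] w := horseshoe_word a0 (@hW w).
exists T; split => [w j jn|w w' /eqP ww'].
  by have [_ /(_ j)] := hT w; rewrite sW => /(_ jn)[].
have [j wj] : exists j : 'I_n, w j <> w' j.
  by apply: contrapT => /forallNP h; apply: ww'; apply/ffunP => j; apply: contrapT.
exists j => //.
have [_ /(_ j)] := hT w; rewrite sW nW => /(_ (ltn_ord j))[/andP[h1 _] /andP[h2 h3]].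
have [_ /(_ j)] := hT w'; rewrite sW nW => /(_ (ltn_ord j))[/andP[h4 _] /andP[h5 h6]].
have [lt|lt|/ord_inj//] := ltngtP (w j) (w' j).
  by apply: (horseshoe_gap a0 _ h1 h4 h3 h5); rewrite ltn_add2l.
by rewrite distrC; apply: (horseshoe_gap a0 _ h4 h1 h6 h2); rewrite ltn_add2l.
Qed.

End horseshoe.

(** * Lower bound for a map that acts by the horseshoe along isometric arcs *)

Section lower_bound.
Context {R : realType} {X : metricType R}.
Variables (phi : X -> X) (arc : nat -> R -> X) (b : R).
Hypothesis b0 : 0 < b.
Hypothesis arc_dist : forall k s t, 0 <= s <= b -> 0 <= t <= b ->
  mdist (arc k s) (arc k t) = `|s - t|.
Hypothesis arc_step : forall k t, 0 <= t <= b ->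
  phi (arc k t) = arc k.+1 (horseshoe t).

Lemma iter_arc j k t :
  (forall i, (i < j)%N -> 0 <= iter i horseshoe t <= b) ->
  iter j phi (arc k t) = arc (k + j) (iter j horseshoe t).
Proof.
elim: j => [|j IH] hj; first by rewrite addn0.
rewrite iterS IH => [|i ij]; last by apply: hj; rewrite ltnS ltnW.
by rewrite arc_step ?addnS ?hj.
Qed.

(** At time [j] all the coded points lie on the same arc [arc j], where distances are differences of
    parameters, so the separation of the codes carries over to [phi]. *)
Lemma sep_ge_pow n eps a M : 0 < a -> 2 * a <= b -> 0 <= eps ->
  eps <= a ^+ 2 * expR (- a^-1) ->
  expR (2 * a)^-1 <= 2 * pi * M%:R -> 4 * pi * M%:R <= expR a^-1 ->
  (((M ^ n)%:R)%:E <= sep n phi eps)%E.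
Proof.
move=> a0 ab eps0 epsa hM1 hM2.
have [T [Ta Tsep]] := horseshoe_code n a0 hM1 hM2.
have Tb w j : (j < n)%N -> 0 <= iter j horseshoe (T w) <= b.
  by move=> /(Ta w)/andP[? ?]; apply/andP; split; lra.
have far w w' : w != w' -> eps < dyn_dist phi n (arc 0 (T w)) (arc 0 (T w')).
  move=> /Tsep[j _]; move=> h; apply: lt_le_trans (le_lt_trans epsa h) _.
  apply: le_trans (le_bigmax _ _ j).
  have lt i : (i < j)%N -> (i < n)%N by move=> /ltn_trans; apply.
  by rewrite !iter_arc; do ?[by move=> i /lt; exact: Tb]; rewrite arc_dist ?Tb.
(* A point has dynamical distance [0] to itself, so separation forces distinct words to give
   distinct points, and the image has exactly [M ^ n] elements. *)
have inj : injective (fun w => arc 0 (T w)).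
  move=> w w' ww'; apply/eqP/negPn/negP => /far; rewrite ww' ltNge => /negP; apply.
  by rewrite /dyn_dist; apply: bigmax_le => // j _; rewrite mdistxx.
apply: ereal_sup_ubound.
exists [fset arc 0 (T w) | w in {: {ffun 'I_n -> 'I_M}}]%fset.
  move=> _ _ /= /imfsetP[w _ ->] /imfsetP[w' _ ->] ww'; apply: far.
  by apply/eqP => ww; apply: ww'; rewrite ww.
by rewrite card_imfset//= -cardE card_ffun !card_ord.
Qed.

Lemma sep_rate_ge eps a M : 0 < a -> 2 * a <= b -> 0 <= eps -> (0 < M)%N ->
  eps <= a ^+ 2 * expR (- a^-1) ->
  expR (2 * a)^-1 <= 2 * pi * M%:R -> 4 * pi * M%:R <= expR a^-1 ->
  ((ln M%:R)%:E <= sep_rate phi eps)%E.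
Proof.
move=> a0 ab eps0 M0 epsa hM1 hM2.
apply: (@limf_esup_ge _ _ _ _ _ _ [set n | (0 < n)%N]).
  by exists 1%N.
move=> n /= n0.
have h := sep_ge_pow n a0 ab eps0 epsa hM1 hM2.
have h' : ((ln M%:R *+ n)%:E <= lne (sep n phi eps))%E.
  rewrite -lnXn ?ltr0n// -natrX -lne_EFin ?ltr0n ?expn_gt0 ?M0//.
  rewrite lee_lne ?in_itv/= ?leey ?andbT ?lee_fin ?ler0n//.
  by apply: le_trans h; rewrite lee_fin ler0n.
apply: (@le_trans _ _ ((n%:R^-1)%:E * (ln M%:R *+ n)%:E)%E).
  by rewrite -EFinM lee_fin -[X in _ * X]mulr_natl mulKf// pnatr_eq0 -lt0n.
by rewrite lee_wpmul2l// lee_fin invr_ge0.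
Qed.

(* With [L = - ln eps], the horseshoe at scale [a = ((1 - k) L)^-1] has about
   [expR ((1 - k) L)] branches and is separated at scale [eps], because
   [expR (- k L)] beats [L ^- 2]. *)
Lemma sep_rate_ge_ln (k eps : R) : 0 < k < 1 -> 0 < eps ->
  2 / ((1 - k) * b) + 12 / (1 - k) + 6 / k ^+ 3 <= - ln eps ->
  (((1 - k) * (- ln eps) - ln 32)%:E <= sep_rate phi eps)%E.
Proof.
move=> /andP[k0 k1] eps0; set L := - ln eps => hL.
have q0 : 0 < 1 - k by lra.
have t1 : 0 < 2 / ((1 - k) * b) by rewrite divr_gt0 ?mulr_gt0.
have t2 : 0 < 12 / (1 - k) by rewrite divr_gt0.
have t3 : 0 < 6 / k ^+ 3 by rewrite divr_gt0 ?exprn_gt0.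
(* The first summand of the threshold ensures [2 * a <= b]; the second gives [7 <= s], which makes
   the rounding in [M] harmless; the third serves the comparison of [L ^+ 2] with [expR (k * L)]. *)
have L1 : 2 / ((1 - k) * b) <= L by lra.
have L2 : 12 / (1 - k) <= L by lra.
have L3 : 6 / k ^+ 3 < L by lra.
have L0 : 0 < L by lra.
set a := ((1 - k) * L)^-1.
have y0 : 0 < (1 - k) * L by rewrite mulr_gt0.
have a0 : 0 < a by rewrite invr_gt0.
have ab : 2 * a <= b.
  move: L1; rewrite ler_pdivrMr ?mulr_gt0// /a ler_pdivrMr// => L1; lra.
have y12 : 12 <= (1 - k) * L by move: L2; rewrite ler_pdivrMr//; lra.
have epsE : eps = expR (- L) by rewrite opprK lnK.
set s := expR (2 * a)^-1.
have s2 : expR a^-1 = s ^+ 2.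
  by rewrite /s -expRM_natl; congr expR; field; rewrite gt_eqF.
have s7 : 7 <= s.
  apply: le_trans (expR_ge1Dx _); rewrite /a invfM invrK; lra.
have epsa : eps <= a ^+ 2 * expR (- a^-1).
  rewrite epsE /a invrK exprVn mulrC ler_pdivlMr ?exprn_gt0//.
  rewrite [leRHS](_ : _ = expR (- L) * expR (k * L)); last first.
    by rewrite -expRD; congr expR; ring.
  rewrite ler_wpM2l ?expR_ge0//.
  apply: (@le_trans _ _ (L ^+ 2)).
    rewrite lerXn2r ?nnegrE ?(ltW L0) ?(ltW y0)// ler_piMl ?(ltW L0)//; lra.
  (* The cubic term of the exponential suffices: [(k * L) ^+ 3 / 6] exceeds [L ^+ 2] as soon as
     [L > 6 / k ^+ 3]. *)
  have := expR_ge1Dxn 2 (ltW (mulr_gt0 k0 L0)).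
  rewrite (_ : 3`!%:R = 6 :> R) // => h.
  have : 6 * L ^+ 2 < (k * L) ^+ 3.
    move: L3; rewrite ltr_pdivrMr ?exprn_gt0// => L3.
    rewrite exprMn [ltRHS](_ : _ = (L * k ^+ 3) * L ^+ 2); last by ring.
    by rewrite ltr_pM2r ?exprn_gt0.
  lra.
(* Since [pi < 4], the divisor [16] yields [4 * pi * M <= s ^+ 2]. Rounding down costs at most
   another factor [2], whence the [ln 32] of the statement. *)
set M := Num.truncn (s ^+ 2 / 16).
have s49 : 49 <= s ^+ 2 by rewrite expr2; nra.
have M1 : M%:R <= s ^+ 2 / 16 by rewrite truncn_le; lra.
have M2 : s ^+ 2 / 16 - 1 < M%:R.
  by have := truncnS_gt (s ^+ 2 / 16); rewrite -/M -natr1; lra.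
have M0 : (0 < M)%N by rewrite truncn_gt0; lra.
have p2 : 2 <= pi :> R := pi_ge2 R.
have p4 : pi < 4 :> R by have := pihalf_lt2 R; lra.
have hM1 : s <= 2 * pi * M%:R.
  apply: (@le_trans _ _ (4 * M%:R)); last by rewrite ler_wpM2r//; lra.
  rewrite expr2 in M2; nra.
have hM2 : 4 * pi * M%:R <= expR a^-1.
  rewrite s2; apply: (@le_trans _ _ (16 * M%:R)); last by lra.
  by rewrite ler_wpM2r//; lra.
apply: le_trans (sep_rate_ge a0 ab (ltW eps0) M0 epsa hM1 hM2).
rewrite lee_fin (_ : (1 - k) * L = ln (s ^+ 2)); last first.
  by rewrite -s2 expRK /a invrK.
rewrite -ln_div ?posrE ?exprn_gt0 ?expR_gt0// ler_ln ?posrE ?ltr0n//.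
  lra.
by rewrite divr_gt0 ?exprn_gt0 ?expR_gt0.
Qed.

(** Divided by [L = - ln eps], the bound of [sep_rate_ge_ln] becomes [1 - k - ln 32 / L], which is
    at least [1 - 2 * k] once [L > ln 32 / k]; then [k] is made arbitrarily small. *)
Lemma lower_mdim_ge1 : (1 <= lower_mdim phi)%E.
Proof.
have main k : 0 < k < 1 -> ((1 - 2 * k)%:E <= lower_mdim phi)%E.
  move=> k01; have /andP[k0 k1] := k01.
  set L0 := 2 / ((1 - k) * b) + 12 / (1 - k) + 6 / k ^+ 3.
  have l0 : 0 < ln 32 / k :> R by rewrite divr_gt0// ln_gt0//; lra.
  have L00 : 0 < L0.
    by rewrite !addr_gt0 ?divr_gt0 ?exprn_gt0 ?mulr_gt0 ?subr_gt0.
  apply: (@limf_einf_ge _ _ _ _ _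
    [set e | 0 < e /\ e < expR (- (L0 + ln 32 / k))]).
    by apply: filterI; [exact: nbhs_right_gt | apply: nbhs_right_lt; exact: expR_gt0].
  move=> e /= [e0 eL].
  have lL : L0 + ln 32 / k < - ln e.
    by rewrite ltrNr -[ltRHS]expRK ltr_ln ?posrE ?expR_gt0.
  have h : L0 <= - ln e by lra.
  have := sep_rate_ge_ln k01 e0 h.
  have le0 : ln e < 0 by lra.
  rewrite ltr0_norm//; set L := - ln e in lL *; have L_gt0 : 0 < L by lra.
  have iL0 : (0 <= (L^-1)%:E)%E by rewrite lee_fin invr_ge0 ltW.
  move=> /(lee_wpmul2r iL0); apply: le_trans; rewrite -EFinM lee_fin ler_pdivlMr//.
  have : ln 32 / k < L by lra.
  by rewrite ltr_pdivrMr//; lra.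
apply/lee_addgt0Pr => e e0; set k := Num.min (1 / 2) (e / 2).
have k01 : 0 < k < 1 by rewrite lt_min gt_min; apply/andP; split; lra.
have ke : k <= e / 2 by rewrite ge_min lexx orbT.
apply: (@le_trans _ _ ((1 - 2 * k)%:E + e%:E)%E).
  by rewrite -EFinD lee_fin; lra.
by rewrite leeD2r// main.
Qed.

End lower_bound.

(* The features of an interval or a circle used in the perturbation. [tr a t] is
   [a] moved by the signed distance [t], stopped at the ends in the case of the
   interval, which is why [tr] is isometric only near the points [p x] of
   [isometric_retract]; [disp a y] is the signed displacement from [a] to [y]. *)
Record translations (R : realType) (X : metricType R) := Translations {
  tr : X -> R -> X ;
  tr0 : forall a, tr a 0 = a ;
  tr_dist : forall a b s t, mdist (tr a s) (tr b t) <= mdist a b + `|s - t| ;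
  tr_radius : R ;
  tr_radius_gt0 : 0 < tr_radius ;
  disp : X -> X -> R ;
  tr_disp : forall a y, mdist a y < tr_radius -> tr a (disp a y) = y ;
  disp_le : forall a y, mdist a y < tr_radius -> `|disp a y| <= mdist a y ;
  disp_continuous : forall a y, mdist a y < tr_radius ->
    {for a, continuous (fun z => disp z y)} ;
  isometric_retract : forall e : R, 0 < e -> exists (r : R) (p : X -> X),
    [/\ 0 < r, continuous p, forall x, mdist x (p x) <= e &
        forall x (s t : R), 0 <= s <= r -> 0 <= t <= r ->
          mdist (tr (p x) s) (tr (p x) t) = `|s - t|] ;
  coord : X -> R ;
  coord01 : forall x, 0 <= coord x <= 1 ;
  coord_dist : forall x y, mdist x y <= `|coord x - coord y|
}.

(** * Perturbing a continuous map near the points of a chain *)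

Section perturbation.
Context {R : realType} {X : metricType R} (S : translations X).
Implicit Types (f g : X -> X) (x y p : X).

Lemma continuous_tr f (v : X -> R) : continuous f -> continuous v ->
  continuous (fun x => tr S (f x) (v x)).
Proof.
move=> fc vc x; apply/metricType_numDomainType.cvgrPdist_lt => e e0.
have e2 : 0 < e / 2 by rewrite divr_gt0.
have /metricType_numDomainType.cvgrPdist_lt/(_ _ e2) fe := fc x.
have /cvgrPdist_lt/(_ _ e2) ve := vc x.
apply: filterS2 fe ve => z h1 h2.
by apply: le_lt_trans (tr_dist S _ _ _ _) _; lra.
Qed.

Lemma continuous_mdist p : continuous (fun x => mdist p x : R).
Proof. exact: mdist_continuous. Qed.

Definition cutoff p (r : R) x : R := Num.max 0 (Num.min 1 (2 - mdist p x / r)).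

Lemma cutoff_continuous p r : continuous (cutoff p r).
Proof.
move=> x.
change {for x, continuous (cst 0 \max (cst 1 \min (fun x => 2 - mdist p x / r)))}.
apply: continuous_max; first exact: cvg_cst.
apply: continuous_min; first exact: cvg_cst.
apply: cvgB; first exact: cvg_cst.
by apply: cvgM; [exact: continuous_mdist|exact: cvg_cst].
Qed.

Lemma cutoff01 p r x : 0 <= cutoff p r x <= 1.
Proof. by rewrite /cutoff le_max lexx/= ge_max ge_min lexx ler01. Qed.

Lemma cutoff_eq1 p r x : 0 < r -> mdist p x <= r -> cutoff p r x = 1.
Proof.
move=> r0 xr; have : mdist p x / r <= 1 by rewrite ler_pdivrMr ?mul1r.
by move=> h; rewrite /cutoff min_l ?max_r//; lra.
Qed.

Lemma cutoff_eq0 p r x : 0 < r -> 2 * r <= mdist p x -> cutoff p r x = 0.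
Proof.
move=> r0 xr; have : 2 <= mdist p x / r by rewrite ler_pdivlMr.
move=> h; rewrite /cutoff max_l// ge_min; apply/orP; right; lra.
Qed.

Lemma disp_cutoff_le f p y r d x : 0 < r -> d < tr_radius S ->
  (forall z, mdist p z < 2 * r -> mdist (f z) y <= d) ->
  `|cutoff p r x * disp S (f x) y| <= cutoff p r x * d.
Proof.
move=> r0 dr fy; have [xr|xr] := ltP (mdist p x) (2 * r); last first.
  by rewrite cutoff_eq0// !mul0r normr0.
have /andP[c0 _] := cutoff01 p r x.
rewrite normrM ger0_norm// ler_wpM2l//.
have h := fy _ xr; apply: le_trans h.
by apply: disp_le; apply: le_lt_trans dr; exact: fy.
Qed.

(** The displacement is controlled only where [f x] is close to [y], that is for [x] in the ball of
    radius [2 * r]. At the other points the product vanishes, and the bound by [cutoff p r x * d]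
    squeezes it to [0]. *)
Lemma disp_cutoff_continuous f p y r d : continuous f -> 0 < r ->
  d < tr_radius S -> (forall z, mdist p z < 2 * r -> mdist (f z) y <= d) ->
  continuous (fun x => cutoff p r x * disp S (f x) y).
Proof.
move=> fc r0 dr fy x; have [xr|xr] := ltP (mdist p x) (2 * r).
  apply: cvgM; first exact: cutoff_continuous.
  apply: (@continuous_comp _ _ _ f (fun z => disp S z y)); first exact: fc.
  by apply: disp_continuous; apply: le_lt_trans dr; exact: fy.
rewrite /continuous_at cutoff_eq0// mul0r.
have c0 : cutoff p r z * d @[z --> x] --> 0.
  rewrite -[X in _ --> X](mul0r d) -(cutoff_eq0 r0 xr).
  by apply: cvgM; [exact: cutoff_continuous|exact: cvg_cst].
apply/cvgr0Pnorm_lt => e e0.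
move/cvgr0Pnorm_lt: c0 => /(_ _ e0); apply: filterS => z h.
apply: le_lt_trans (disp_cutoff_le z r0 dr fy) _.
exact: le_lt_trans (ler_norm _) h.
Qed.

Lemma tr_dist_l x s : mdist x (tr S x s) <= `|s|.
Proof.
have := tr_dist S x x 0 s; rewrite tr0 mdistxx add0r sub0r normrN; exact.
Qed.

(** Inside radius [r] the pull to [y] is complete and only the motion by [h] is visible; between [r]
    and [2 * r] the function [h] vanishes while the pull fades out. The pull costs at most [d] and
    the motion at most [r]. *)
Lemma patch f p y (r d : R) (h : R -> R) : continuous f -> 0 < r ->
  0 <= d < tr_radius S -> (forall z, mdist p z < 2 * r -> mdist (f z) y <= d) ->
  continuous h -> (forall t, r <= t -> h t = 0) ->
  (forall t, 0 <= t -> 0 <= h t <= r) ->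
  exists g, [/\ continuous g,
    forall x, mdist p x <= r -> g x = tr S y (h (mdist p x)),
    forall x, 2 * r <= mdist p x -> g x = f x &
    forall x, mdist (f x) (g x) <= d + r].
Proof.
move=> fc r0 /andP[d0 dr] fy hc hr h01.
(* Near [p], [f x] is first pulled to [y], then moved by [h]. *)
exists (fun x => tr S (tr S (f x) (cutoff p r x * disp S (f x) y))
                    (h (mdist p x))); split.
- apply: continuous_tr.
    by apply: continuous_tr => //; exact: disp_cutoff_continuous dr fy.
  move=> x; apply: (@continuous_comp _ _ _ (mdist p) h).
    exact: continuous_mdist.
  exact: hc.
- move=> x xr; rewrite cutoff_eq1// mul1r tr_disp//.
  by apply: le_lt_trans dr; apply: fy; lra.
- move=> x xr; rewrite cutoff_eq0// mul0r tr0 hr ?tr0//; lra.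
- move=> x; apply: le_trans
    (metric_triangle _ (tr S (f x) (cutoff p r x * disp S (f x) y)) _) _.
  apply: lerD.
    apply: le_trans (tr_dist_l _ _) _.
    apply: le_trans (disp_cutoff_le _ r0 dr fy) _.
    by rewrite ler_piMl//; case/andP: (cutoff01 p r x).
  apply: le_trans (tr_dist_l _ _) _.
  by have /andP[h0 h1] := h01 _ (mdist_ge0 p x); rewrite ger0_norm.
Qed.

(** The points are patched one at a time. Their balls of radius [2 * r] are disjoint, so a new patch
    neither disturbs the earlier ones nor adds to their error. *)
Lemma patch_chain f (x_ y_ : nat -> X) (r d : R) (h : R -> R) q :
  continuous f -> 0 < r -> 0 <= d < tr_radius S ->
  (forall k l, (k < l < q)%N -> 4 * r <= mdist (x_ k) (x_ l)) ->
  (forall k z, (k < q)%N -> mdist (x_ k) z < 2 * r -> mdist (f z) (y_ k) <= d) ->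
  continuous h -> (forall t, r <= t -> h t = 0) ->
  (forall t, 0 <= t -> 0 <= h t <= r) ->
  exists g, [/\ continuous g,
    forall k x, (k < q)%N -> mdist (x_ k) x <= r ->
      g x = tr S (y_ k) (h (mdist (x_ k) x)) &
    forall x, mdist (f x) (g x) <= d + r].
Proof.
move=> fc r0 dr xfar fy hc hr h01; have /andP[d0 _] := dr.
(* The induction also records that [g] still equals [f] away from the balls already treated. *)
suff : forall m, (m <= q)%N -> exists g, [/\ continuous g,
    forall k x, (k < m)%N -> mdist (x_ k) x <= r ->
      g x = tr S (y_ k) (h (mdist (x_ k) x)),
    forall x, (forall k, (k < m)%N -> 2 * r <= mdist (x_ k) x) -> g x = f x &
    forall x, mdist (f x) (g x) <= d + r].
  by move=> /(_ q (leqnn q))[g [? ? ? ?]]; exists g.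
elim=> [_|m IH mq].
  by exists f; split => // x; rewrite mdistxx addr_ge0// ltW.
have [g [gc gk gf gd]] := IH (ltnW mq).
have away k x : (k < m)%N ->
    2 * r <= mdist (x_ m) x \/ 2 * r <= mdist (x_ k) x.
  move=> km; have := xfar k m; rewrite km mq => /(_ isT).
  have := metric_triangle (x_ k) x (x_ m); rewrite (metric_sym x).
  by have [|] := leP (2 * r) (mdist (x_ m) x); [left|right; lra].
have gy z : mdist (x_ m) z < 2 * r -> g z = f z.
  move=> zm; apply: gf => k km.
  by have [|//] := away k z km; rewrite leNgt zm.
have [|g' [g'c g'm g'g g'd]] := @patch g (x_ m) (y_ m) r d h gc r0 dr _ hc hr h01.
  by move=> z zm; rewrite gy//; exact: fy.
exists g'; split => //.
- move=> k x; rewrite ltnS leq_eqVlt => /predU1P[->|km xr]; first exact: g'm.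
  have xm : 2 * r <= mdist (x_ m) x by case: (away k x km) => // ?; lra.
  by rewrite (g'g _ xm) (gk k).
- move=> x xk; rewrite g'g ?xk// gf// => k km; apply: xk.
  by rewrite ltnS ltnW.
- move=> x; have [xm|xm] := ltP (mdist (x_ m) x) (2 * r).
    by rewrite -gy.
  by rewrite g'g.
Qed.

(** Among [N + 1] iterates two share one of [N] small cells, which gives a near return. The time [q]
    is minimal over all starting points of the orbit, so two close points at times [k < l < q] would
    contradict minimality through [l - k]. Starting at [i.+1] keeps the chain in the image of
    [f]. *)
Lemma pseudo_periodic_chain f x0 (e : R) : 0 < e < 1 ->
  exists i q, [/\ (0 < q)%N,
    mdist (iter (i.+1 + q) f x0) (iter i.+1 f x0) < e &
    forall k l, (k < l < q)%N ->
      e <= mdist (iter (i.+1 + k) f x0) (iter (i.+1 + l) f x0)].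
Proof.
move=> e01.
have [N [cell [_ cellP]]] := ex_small_cells (coord01 S) (coord_dist S) e01.
pose P q := `[< (0 < q)%N /\ exists i,
  mdist (iter (i.+1 + q) f x0) (iter i.+1 f x0) < e >].
have exP : exists q, P q.
  pose F (j : 'I_N.+1) := cell (iter j.+1 f x0).
  have /injectivePn[j [j' jj' FF]] : ~~ injectiveb F.
    apply/negP => /injectiveP /leq_card; rewrite !card_ord; lia.
  wlog lt : j j' jj' FF / (j < j')%N.
    move=> H; have [lt|lt|eq] := ltngtP j j'; first exact: (H j j').
      by apply: (H j' j) => //; rewrite eq_sym.
    by move: jj'; rewrite (ord_inj eq) eqxx.
  exists (j' - j)%N; apply/asboolP; split; first by rewrite subn_gt0.
  exists j; rewrite addSn subnKC ?(ltnW lt)//; apply: cellP; exact: esym.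
case: (ex_minnP exP) => q /asboolP[q0 [i qi]] qmin.
exists i, q; split => // k l /andP[kl lq].
rewrite leNgt; apply/negP => h.
have : P (l - k)%N.
  apply/asboolP; split; first by rewrite subn_gt0.
  exists (i + k)%N; rewrite -addSn -addnA subnKC ?(ltnW kl)//.
  by rewrite metric_sym.
move=> /qmin; lia.
Qed.

End perturbation.

(** * Density of the maps of metric mean dimension one *)

Section density.
Context {R : realType}.

(** The cap makes the map vanish from [r] on and stay below [r], as [patch] requires. Since
    [horseshoe t <= 2 * t], it has no effect for [t <= r / 4]. *)
Definition bounded_horseshoe (r t : R) : R :=
  Num.min (horseshoe t) (Num.max 0 (r - t)).

Lemma bounded_horseshoe_continuous r : continuous (bounded_horseshoe r).
Proof.
move=> t.
change {for t, continuous (horseshoe \min (cst 0 \max (fun t => r - t)))}.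
apply: continuous_min; first exact: continuous_horseshoe.
apply: continuous_max; first exact: cvg_cst.
by apply: cvgB; [exact: cvg_cst|exact: cvg_id].
Qed.

Lemma bounded_horseshoe_eq0 r t : 0 < r -> r <= t -> bounded_horseshoe r t = 0.
Proof.
move=> r0 rt; rewrite /bounded_horseshoe max_l; last by rewrite subr_le0.
by rewrite min_r// horseshoe_ge0//; lra.
Qed.

Lemma bounded_horseshoe_itv r t : 0 < r -> 0 <= t ->
  0 <= bounded_horseshoe r t <= r.
Proof.
move=> r0 t0; rewrite /bounded_horseshoe le_min horseshoe_ge0// le_max lexx/=.
by rewrite ge_min ge_max (ltW r0) gerBl t0 orbT.
Qed.

Lemma bounded_horseshoeE r t : 0 <= t <= r / 4 ->
  bounded_horseshoe r t = horseshoe t.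
Proof.
move=> /andP[t0 tr]; rewrite /bounded_horseshoe min_l// le_max.
by apply/orP; right; have := horseshoe_le t0; lra.
Qed.

Context {X : compactMetricType R} (S : translations X).

Lemma mdim1_approx (x0 : X) (f : C0 X) (e : R) : 0 < e ->
  exists phi : C0 X, [/\ mdist f phi < e, lower_mdim phi = 1%E &
                         upper_mdim phi = 1%E].
Proof.
move=> e0; have e8 : 0 < e / 8 by lra.
have [rho [p [rho0 pc pd piso]]] := isometric_retract S e8.
pose f1 x := p (f x).
have f1c : continuous f1.
  by move=> x; apply: (@continuous_comp _ _ _ f p); [exact: cts_fun|exact: pc].
(* The total error is at most [e / 8] for the retraction plus [2 * d + r] for the patches, hence
   below [e / 2]. The other bounds give [2 * d < tr_radius S] and [d < 1]. *)
set d := Num.min (e / 16) (Num.min (tr_radius S / 4) (1 / 2)).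
have rad0 := tr_radius_gt0 S.
have d0 : 0 < d by rewrite !lt_min; apply/and3P; split; lra.
have d1 : d <= e / 16 by rewrite ge_min lexx.
have d2 : d <= tr_radius S / 4 by rewrite !ge_min lexx/= orbT.
have d3 : d <= 1 / 2 by rewrite !ge_min lexx/= !orbT.
have [|i [q [q0 xclose xfar]]] := pseudo_periodic_chain S f1 x0 (e := d).
  by apply/andP; split; lra.
pose x_ k := iter (i.+1 + k) f1 x0.
have x_S k : x_ k.+1 = f1 (x_ k) by rewrite /x_ addnS.
(* Every [x_ k] is a value of [f1], hence of [p], so the arc issued from it is isometric. *)
have x_iso k s t : 0 <= s <= rho -> 0 <= t <= rho ->
    mdist (tr S (x_ k) s) (tr S (x_ k) t) = `|s - t|.
  by move=> s01 t01; rewrite /x_ addSn iterS; exact: piso.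
(* The reduction modulo [q] closes the chain: the last target is [x_ 0], within [d] of the true
   image [x_ q]. *)
pose y_ k := x_ (k.+1 %% q)%N.
have y_close k : (k < q)%N -> mdist (f1 (x_ k)) (y_ k) < d.
  move=> kq; rewrite -x_S /y_.
  have [kq1|kq1] := ltnP k.+1 q; first by rewrite modn_small// mdistxx.
  have -> : k.+1 = q by apply/eqP; rewrite eqn_leq kq kq1.
  by rewrite modnn /x_ addn0.
near (0 : R)^'+ => r.
have r0 : 0 < r by near: r; exact: nbhs_right_gt.
have r1 : r < d / 4 by near: r; apply: nbhs_right_lt; rewrite divr_gt0.
have r2 : r < rho by near: r; exact: nbhs_right_lt.
(* Continuity at finitely many points gives a common radius. This [d] and the one of [y_close] add
   up to the [2 * d] passed to [patch_chain]. *)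
have fr : forall k : 'I_q, forall z, mdist (x_ k) z < 2 * r ->
    mdist (f1 z) (f1 (x_ k)) <= d.
  near: r; apply: filter_forall => k.
  have /metricType_numDomainType.cvgrPdist_lt/(_ _ d0) := f1c (x_ k).
  move=> /metricType_numDomainType.nbhs_mdistP[s /= s0 sd].
  have s2 : 0 < s / 2 by rewrite divr_gt0.
  apply: filterS (nbhs_right_lt s2) => r' r's z zr.
  by rewrite metric_sym ltW//; apply: sd => /=; lra.
have [||||||g [gc gk gd]] := @patch_chain R X S f1 x_ y_ r (2 * d)
    (bounded_horseshoe r) q f1c r0.
- by apply/andP; split; lra.
- by move=> k l kl; apply: le_trans (xfar _ _ kl); lra.
- move=> k z kq zr; have := fr (Ordinal kq) z zr; have := y_close k kq.
  by have := metric_triangle (f1 z) (f1 (x_ k)) (y_ k) => /=; lra.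
- exact: bounded_horseshoe_continuous.
- by move=> t; exact: bounded_horseshoe_eq0.
- by move=> t; exact: bounded_horseshoe_itv.
pose phi : C0 X := mkcts gc.
have low : (1 <= lower_mdim phi)%E.
  apply: (@lower_mdim_ge1 R X phi (fun k t => tr S (x_ (k %% q)%N) t) (r / 4)).
  - by rewrite divr_gt0.
  - move=> k s t /andP[s0 s1] /andP[t0 t1].
    by apply: x_iso; apply/andP; split; lra.
  - move=> k t t01; have /andP[t0 t1] := t01.
    (* The patched map depends on the distance to the centre, which along the arc is the parameter
       itself. *)
    have dt : mdist (x_ (k %% q)%N) (tr S (x_ (k %% q)%N) t) = t.
      rewrite -{1}(tr0 S (x_ (k %% q)%N)) x_iso ?sub0r ?normrN ?ger0_norm//.
        by rewrite lexx ltW.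
      by apply/andP; split; lra.
    rewrite -[phi _]/(g _) (gk (k %% q)%N) ?ltn_pmod// dt ?bounded_horseshoeE//; last by lra.
    by rewrite /y_ -[(k %% q).+1]addn1 modnDml addn1.
have up : (upper_mdim phi <= 1)%E.
  exact: upper_mdim_le1 x0 (coord01 S) (coord_dist S).
have lu := lower_mdim_le_upper phi.
exists phi; split; last 2 first.
- by apply/eqP; rewrite eq_le low (le_trans lu up).
- by apply/eqP; rewrite eq_le up (le_trans low lu).
apply: (@le_lt_trans _ _ (e / 2)); last by lra.
apply: unif_dist_le => [|x]; first by lra.
apply: le_trans (metric_triangle _ (f1 x) _) _.
have := pd (f x); have := gd x; rewrite /f1 /=; lra.
Unshelve. all: by end_near. Qed.

Lemma dense_mdim1 (x0 : X) :
  dense [set phi : C0 X | lower_mdim phi = 1%E] /\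
  dense [set phi : C0 X | upper_mdim phi = 1%E].
Proof.
have near_open (O : set (C0 X)) : O !=set0 -> open O -> exists phi : C0 X,
    [/\ O phi, lower_mdim phi = 1%E & upper_mdim phi = 1%E].
  move=> [f Of] Oo; have /nbhs_ballP[e /= e0 eO] := open_nbhs_nbhs (conj Oo Of).
  have [phi [fphi lo up]] := mdim1_approx x0 f e0.
  by exists phi; split => //; apply: eO; rewrite ballEmdist.
by split=> O O0 Oo; have [phi [Ophi lo up]] := near_open O O0 Oo; exists phi.
Qed.

End density.

(** * Translations of the unit interval *)

Section interval_translations.
Context (R : realType).
Local Notation I := (unit_interval R).

Definition clamp01 (z : R) : R := Num.max 0 (Num.min 1 z).

Lemma clamp01_in z : clamp01 z \in (`[0%R, 1%R]%classic : set R).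
Proof.
apply: mem_set; rewrite /= in_itv/= /clamp01.
by rewrite le_max lexx/= ge_max ler01 ge_min lexx.
Qed.

Definition to_interval (z : R) : I := exist _ (clamp01 z) (clamp01_in z).

Lemma interval_val01 (a : I) : 0 <= set_val a <= 1.
Proof. by have := set_mem (valP a); rewrite /= in_itv. Qed.

Lemma clamp01E z : 0 <= z <= 1 -> clamp01 z = z.
Proof. by move=> /andP[z0 z1]; rewrite /clamp01 min_r// max_r. Qed.

Lemma clamp01_dist y z : `|clamp01 y - clamp01 z| <= `|y - z|.
Proof.
have := ler_norm (y - z); have := ler_norm (z - y); rewrite (distrC z y) => h1 h2.
rewrite ler_norml /clamp01.
by have [?|?] := leP 1 y; have [?|?] := leP 1 z; rewrite ?(max_r ler01);
  have [?|?] := leP 0 y; have [?|?] := leP 0 z; apply/andP; split; lra.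
Qed.

Lemma interval_mdistE (a b : I) : mdist a b = `|set_val a - set_val b|.
Proof. by []. Qed.

Lemma to_interval_val (z : R) : set_val (to_interval z) = clamp01 z.
Proof. by []. Qed.

Lemma to_intervalK (a : I) : to_interval (set_val a) = a.
Proof. by apply: val_inj; exact: clamp01E (interval_val01 a). Qed.

Lemma interval_val_continuous : continuous (set_val : I -> R).
Proof.
exact: initial_continuous.
Qed.

Lemma to_interval_continuous : continuous to_interval.
Proof.
move=> x; apply/metricType_numDomainType.cvgrPdist_lt => e e0.
apply: (filterS _ (nbhsx_ballx x e e0)) => y xy.
exact: le_lt_trans (clamp01_dist _ _) xy.
Qed.

Lemma interval_translations : translations I.
Proof.
apply: (@Translations R I (fun a t => to_interval (set_val a + t)) _ _ 1 _
  (fun a y => set_val y - set_val a) _ _ _ _ set_val).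
- by move=> a; rewrite addr0 to_intervalK.
- move=> a b s t; apply: le_trans (clamp01_dist _ _) _.
  by rewrite interval_mdistE opprD addrACA ler_normD.
- exact: ltr01.
- by move=> a y _; rewrite addrC subrK to_intervalK.
- by move=> a y _; rewrite interval_mdistE distrC.
- move=> a y _.
  apply: (@continuous_comp _ _ _ (set_val : I -> R) (fun z => set_val y - z)).
    exact: interval_val_continuous.
  by apply: cvgB; [exact: cvg_cst|exact: cvg_id].
(* Capping at [1 - r] moves points by at most [r <= e] and leaves room [r] on the right, so that
   clamping has no effect on the arcs. *)
- move=> e e0; set r := Num.min e (1 / 2).
  have r0 : 0 < r by rewrite lt_min e0; lra.
  have re : r <= e by rewrite ge_min lexx.
  have r1 : r <= 1 / 2 by rewrite ge_min lexx orbT.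
  have val_p (x : I) : set_val (to_interval (Num.min (set_val x) (1 - r)))
      = Num.min (set_val x) (1 - r).
    rewrite to_interval_val clamp01E//; have /andP[x0 x1] := interval_val01 x.
    by rewrite le_min ge_min x0 x1/= andbT; lra.
  exists r, (fun x => to_interval (Num.min (set_val x) (1 - r))); split => //.
  + move=> x; apply: (@continuous_comp _ _ _ (set_val : I -> R)
      (fun z => to_interval (Num.min z (1 - r)))).
      exact: interval_val_continuous.
    apply: (@continuous_comp _ _ _ (fun z : R => Num.min z (1 - r))).
      change {for set_val x, continuous (id \min cst (1 - r))}.
      by apply: continuous_min; [exact: cvg_id|exact: cvg_cst].
    exact: to_interval_continuous.
  + move=> x; rewrite interval_mdistE val_p; have /andP[x0 x1] := interval_val01 x.
    by rewrite /Num.min; case: ltP => h; rewrite ler_norml; lra.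
  + move=> x s t /andP[s0 s1] /andP[t0 t1].
    rewrite val_p interval_mdistE !to_interval_val.
    have h : Num.min (set_val x) (1 - r) <= 1 - r by rewrite ge_min lexx orbT.
    have h0 : 0 <= Num.min (set_val x) (1 - r).
      by have /andP[x0 x1] := interval_val01 x; rewrite le_min x0; lra.
    rewrite !clamp01E; [|by apply/andP; split; lra..].
    by congr (`| _ |); ring.
- exact: interval_val01.
- by [].
Qed.

End interval_translations.

Lemma metric_continuous_at (R : realType) (X : metricType R) (v : X -> R) a :
  (forall e, 0 < e -> exists2 d : R, 0 < d &
    forall z, mdist a z < d -> `|v a - v z| < e) ->
  {for a, continuous v}.
Proof.
move=> h; apply/cvgrPdist_lt => e /h[d d0 hd].
by apply: (filterS _ (nbhsx_ballx a d d0)) => z; rewrite ballEmdist; exact: hd.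
Qed.

(** * Translations of the circle *)

Section circle_translations.
Context (R : realType).
Local Notation C := (circle R).

Lemma circle_reprK (a : C) : to_circle (repr a) = a.
Proof. by rewrite /to_circle reprK. Qed.

(** This is the representative of [z] modulo the integers in [[-1/2, 1/2)]. *)
Definition int_residue (z : R) : R := z - (Num.floor (z + 1 / 2))%:~R.

Lemma int_residue_int z : (z - int_residue z) \is a Num.int.
Proof. by rewrite /int_residue opprB addrC subrK intr_int. Qed.

Lemma int_residue_le z : `|int_residue z| <= 1 / 2.
Proof.
rewrite /int_residue ler_norml.
have := floor_le_tmp (z + 1 / 2); have := floorD1_gt (z + 1 / 2).
by rewrite intrD => h1 h2; apply/andP; split; lra.
Qed.

Lemma int_norm_lt1 (z : R) : z \is a Num.int -> `|z| < 1 -> z = 0.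
Proof.
move=> /intrP[k ->]; rewrite -intr_norm ltrz1 => k1.
by have -> : k = 0 by lia.
Qed.

(** If [u] and [w] differ, they do so by at least [1], hence [w] has absolute value at least
    [1 / 2]. *)
Lemma norm_int_residue_le u w : `|u| <= 1 / 2 -> (u - w) \is a Num.int ->
  `|u| <= `|w| :> R.
Proof.
move=> u2 uw; have [uw1|uw1] := ltP `|u - w| 1.
  by have /eqP := int_norm_lt1 uw uw1; rewrite subr_eq0 => /eqP ->.
by have := ler_normB u w; lra.
Qed.

Definition circle_disp (a y : C) : R := int_residue (repr y - repr a).

Lemma circle_dispE x y :
  (circle_disp (to_circle x) (to_circle y) - (y - x)) \is a Num.int.
Proof.
rewrite /circle_disp.
have /to_circle_eqP hx := circle_reprK (to_circle x).
have /to_circle_eqP hy := circle_reprK (to_circle y).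
rewrite /int_eq in hx hy; set u := repr _ in hy *; set v := repr _ in hx *.
have h := int_residue_int (u - v).
rewrite (_ : _ - (y - x) = - (u - v - int_residue (u - v)) + ((u - y) - (v - x))); last by ring.
by rewrite rpredD ?rpredN// rpredB.
Qed.

(** The displacement is congruent to every difference of representatives and is minimal in its
    class, so it is bounded by the infimum that defines the distance. *)
Lemma circle_disp_norm (a y : C) : `|circle_disp a y| <= mdist a y.
Proof.
apply/ler_addgt0Pr => e e0.
have [u [v [<- <- uv]]] := circle_dist_adherent a y e0.
apply: le_trans (ltW uv); rewrite [leRHS]distrC.
apply: norm_int_residue_le; first exact: int_residue_le.
exact: circle_dispE.
Qed.

Definition circle_tr (a : C) (t : R) : C := to_circle (repr a + t).

(** Independence of the chosen representative lets [circle_tr_dist] work with nearly optimal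
    ones. *)
Lemma circle_trE x t : circle_tr (to_circle x) t = to_circle (x + t).
Proof.
have /to_circle_eqP := circle_reprK (to_circle x); rewrite /int_eq => h.
apply/to_circle_eqP; rewrite /int_eq.
by rewrite [X in X \is a _](_ : _ = repr (to_circle x) - x)//; ring.
Qed.

Lemma circle_tr_dist (a b : C) (s t : R) :
  mdist (circle_tr a s) (circle_tr b t) <= mdist a b + `|s - t|.
Proof.
apply/ler_addgt0Pr => e e0.
have [u [v [ua vb uv]]] := circle_dist_adherent a b e0.
rewrite -{1}ua -{1}vb !circle_trE; apply: le_trans (circle_dist_le _ _) _.
rewrite (_ : u + s - (v + t) = (u - v) + (s - t)); last by ring.
apply: le_trans (ler_normD _ _) _.
change (mdist a b) with (circle_dist a b); lra.
Qed.

(** Displacements add up modulo the integers. The defect is an integer of absolute value below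
    [1 / 4 + 1 / 2 + 1 / 4], so it is [0], and the difference is exactly [circle_disp a z]. *)
Lemma circle_disp_dist (a z y : C) : mdist a y < 1 / 4 -> mdist a z < 1 / 4 ->
  `|circle_disp a y - circle_disp z y| <= mdist a z.
Proof.
move=> ay az.
have zy : mdist z y < 1 / 2.
  by have := metric_triangle z a y; rewrite (metric_sym z a); lra.
have n1 := circle_disp_norm a y; have n2 := circle_disp_norm z y.
have n3 := circle_disp_norm a z.
suff /eqP : circle_disp a y - circle_disp z y - circle_disp a z = 0.
  by rewrite subr_eq0 => /eqP ->.
apply: int_norm_lt1; last first.
  apply: le_lt_trans (ler_normB _ _) _.
  by have := ler_normB (circle_disp a y) (circle_disp z y); lra.
have h1 := int_residue_int (repr y - repr a).
have h2 := int_residue_int (repr y - repr z).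
have h3 := int_residue_int (repr z - repr a).
rewrite -/(circle_disp a y) -/(circle_disp z y) -/(circle_disp a z) in h1 h2 h3.
rewrite (_ : _ - _ - _ = (repr y - repr z - circle_disp z y)
  + (repr z - repr a - circle_disp a z) - (repr y - repr a - circle_disp a y)).
  by rewrite rpredB// rpredD.
by ring.
Qed.

Lemma circle_disp_continuous (a y : C) : mdist a y < 1 / 4 ->
  {for a, continuous (circle_disp ^~ y)}.
Proof.
move=> ay; apply: metric_continuous_at => e e0; exists (Num.min e (1 / 4)).
  by rewrite lt_min e0; lra.
move=> z; rewrite lt_min => /andP[ze z4].
by apply: le_lt_trans ze; exact: circle_disp_dist.
Qed.

Lemma circle_translations : translations C.
Proof.
apply: (@Translations R C circle_tr _ circle_tr_dist (1 / 4) _ circle_disp _ _ _ _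
  (fun a => repr a - (Num.floor (repr a))%:~R)).
- by move=> a; rewrite /circle_tr addr0 circle_reprK.
- by lra.
- move=> a y _; rewrite -[RHS]circle_reprK; apply/to_circle_eqP; rewrite /int_eq.
  have := int_residue_int (repr y - repr a); rewrite -/(circle_disp a y) => h.
  rewrite (_ : _ - repr y = - (repr y - repr a - circle_disp a y)) ?rpredN//.
  by ring.
- by move=> a y _; exact: circle_disp_norm.
- exact: circle_disp_continuous.
(* The circle has no ends, so the identity serves as retraction. For parameters in [[0, 1/4]] the
   difference [t - s] is at most [1 / 2] in absolute value, hence minimal in its class. *)
- move=> e e0; exists (1 / 4), id; split.
  + by lra.
  + by move=> x; exact: cvg_id.
  + by move=> x; rewrite mdistxx ltW.
  + move=> x s t /andP[s0 s1] /andP[t0 t1]; apply/eqP; rewrite eq_le.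
    apply/andP; split.
      by have := circle_tr_dist x x s t; rewrite mdistxx add0r.
    rewrite distrC; apply: le_trans (circle_disp_norm _ _).
    have := circle_dispE (repr x + s) (repr x + t).
    rewrite -opprB rpredN => h; apply: norm_int_residue_le.
      by rewrite ler_norml; apply/andP; split; lra.
    rewrite (_ : t - s = repr x + t - (repr x + s)); last by ring.
    exact: h.
- move=> a; have := floor_le_tmp (repr a); have := floorD1_gt (repr a).
  by rewrite intrD => h1 h2; apply/andP; split; lra.
(* The coordinate, a fractional part, is itself a representative, so the quotient distance is at
   most the difference of coordinates even though the coordinate jumps at the class of [0]. *)
- move=> a b.
  have tc (c : C) : to_circle (repr c - (Num.floor (repr c))%:~R) = c.
    rewrite -[RHS]circle_reprK; apply/to_circle_eqP; rewrite /int_eq.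
    by rewrite (_ : _ - repr c = - (Num.floor (repr c))%:~R) ?rpredN ?intr_int//; ring.
  by rewrite -{1}(tc a) -{1}(tc b); exact: circle_dist_le.
Qed.

End circle_translations.

Theorem corollary4p9 (R : realType) :
  (dense [set phi : C0 (unit_interval R) | lower_mdim phi = 1%E] /\
   dense [set phi : C0 (unit_interval R) | upper_mdim phi = 1%E]) /\
  (dense [set phi : C0 (circle R) | lower_mdim phi = 1%E] /\
   dense [set phi : C0 (circle R) | upper_mdim phi = 1%E]).
Proof.
split.
  exact: (dense_mdim1 (interval_translations R) (to_interval 0)).
exact: (dense_mdim1 (circle_translations R) (to_circle 0)).
Qed.
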